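(* Let $\Omega=(a,b)\times(c,d)\subset\mathbb{R}^2$ be a bounded open rectangle. Then the comparison principle holds for $\mathcal{M}_{\mathfrak{g}}$-admissible viscosity sub/supersolutions of $$u_x^2-u_y^2=0$$ in the form: if $u\in\mathrm{USC}(\overline{\Omega})$ is an $\mathcal{M}_{\mathfrak{g}}$-admissible subsolution in $\Omega$ and $v\in\mathrm{LSC}(\overline{\Omega})$ is an $\mathcal{M}_{\mathfrak{g}}$-admissible supersolution in $\Omega$, then $$u\le v\ \text{on }\partial\Omega\setminus\{x=a\}\quad\Longrightarrow\quad u\le v\ \text{in }\Omega.$$
   Context: $\mathcal{S}(2)$ is the space of real symmetric $2\times2$ matrices, $\mathfrak{g}(p_1,p_2)=p_1^2-p_2^2$ and $$\mathcal{M}_{\mathfrak{g}}=\mathbb{R}\times\{p\in\mathbb{R}^2:p_1-|p_2|\ge0\}\times\mathcal{S}(2).$$ $\mathrm{USC}$ (resp. $\mathrm{LSC}$) denotes upper (lower) semicontinuous functions with values in $[-\infty,+\infty)$ (resp. $(-\infty,+\infty]$). For $z\in\Omega$, $J^{2,+}_zu$ (resp. $J^{2,-}_zu$) is the set of $(\varphi(z),D\varphi(z),D^2\varphi(z))$ with $\varphi$ of class $C^2$ near $z$ and $u\le\varphi$ (resp. $u\ge\varphi$) near $z$ with equality at $z$. $u$ is an $\mathcal{M}_{\mathfrak{g}}$-admissible viscosity subsolution in $\Omega$ if for every $z\in\Omega$ and $J=(r,p,A)\in J^{2,+}_zu$ one has $J\in\mathcal{M}_{\mathfrak{g}}$ and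 $\mathfrak{g}(p)\ge0$. $v$ is an $\mathcal{M}_{\mathfrak{g}}$-admissible viscosity supersolution in $\Omega$ if for every $z\in\Omega$ and $J=(r,p,A)\in J^{2,-}_zv$, either $J\in\mathcal{M}_{\mathfrak{g}}$ and $\mathfrak{g}(p)\le0$, or $J\notin\mathcal{M}_{\mathfrak{g}}$. *)

(* Defs.v *)
From HB Require Import structures.
From mathcomp Require Import all_boot all_order all_algebra.
From mathcomp Require Import all_classical all_reals all_analysis.

Set Implicit Arguments.
Unset Strict Implicit.
Unset Printing Implicit Defensive.

Import Order.TTheory GRing.Theory Num.Theory.
Import numFieldNormedType.Exports.

Local Open Scope classical_set_scope.
Local Open Scope ring_scope.

Section Semicontinuity.
Context {R : realType}.

(* The counterpart of [lower_semicontinuous], which the library provides. *)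
Definition upper_semicontinuous (X : topologicalType) (f : X -> \bar R) :=
  forall x a, (f x < a%:E)%E ->
    exists2 V, nbhs x V & forall y, V y -> (f y < a%:E)%E.

(* Functions on D are represented by total functions on X. Their values off D
   are irrelevant: in [subspace D] every point off D is isolated, and it is not
   in any small neighbourhood of a point of D. *)
Definition USC (X : topologicalType) (D : set X) (f : X -> \bar R) :=
  (forall x, D x -> f x < +oo)%E /\
  upper_semicontinuous (f : subspace D -> \bar R).

Definition LSC (X : topologicalType) (D : set X) (f : X -> \bar R) :=
  (forall x, D x -> -oo < f x)%E /\
  lower_semicontinuous (f : subspace D -> \bar R).

End Semicontinuity.

Definition boundary (X : topologicalType) (A : set X) : set X :=
  closure A `\` interior A.

Section Jets.
Context {R : realType}.
Local Notation plane := 'rV[R]_2.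

Definition sym2 : Type := {A : 'M[R]_2 | A^T == A}.

(* Requiring [val A = hessian phi z] below loses no jet: the Hessian of a C^2
   function is symmetric (Schwarz). *)
Definition jet : Type := (R * plane * sym2)%type.

Definition partial (i : 'I_2) (phi : plane -> R) : plane -> R :=
  'D_(delta_mx 0 i) phi.

Definition gradient (phi : plane -> R) (z : plane) : plane :=
  \row_i partial i phi z.

Definition hessian (phi : plane -> R) (z : plane) : 'M[R]_2 :=
  \matrix_(i, j) partial i (partial j phi) z.

Definition C2_near (z : plane) (phi : plane -> R) :=
  \forall w \near z,
    [/\ differentiable phi w, differentiable (gradient phi) w
      & {for w, continuous (hessian phi)}].

Definition upper_jets (z : plane) (u : plane -> \bar R) : set jet :=
  [set J | exists phi : plane -> R,
     [/\ C2_near z phi,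
         (\forall w \near z, u w <= (phi w)%:E)%E,
         u z = (phi z)%:E
       & [/\ J.1.1 = phi z, J.1.2 = gradient phi z
           & val J.2 = hessian phi z]]].

Definition lower_jets (z : plane) (v : plane -> \bar R) : set jet :=
  [set J | exists phi : plane -> R,
     [/\ C2_near z phi,
         (\forall w \near z, (phi w)%:E <= v w)%E,
         v z = (phi z)%:E
       & [/\ J.1.1 = phi z, J.1.2 = gradient phi z
           & val J.2 = hessian phi z]]].

Definition admissible_subsolution (M : set jet) (g : plane -> R)
    (Omega : set plane) (u : plane -> \bar R) :=
  forall z, Omega z -> forall J, upper_jets z u J -> M J /\ 0 <= g J.1.2.

Definition admissible_supersolution (M : set jet) (g : plane -> R)
    (Omega : set plane) (v : plane -> \bar R) :=
  forall z, Omega z -> forall J, lower_jets z v J ->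
    (M J /\ g J.1.2 <= 0) \/ ~ M J.

(* The equation u_x^2 - u_y^2 = 0 reads gfrak (gradient u) = 0. *)
Definition gfrak (p : plane) : R := p 0 0 ^+ 2 - p 0 1 ^+ 2.

Definition Mg : set jet :=
  [set: R] `*` [set p : plane | 0 <= p 0 0 - `|p 0 1|] `*` [set: sym2].

Definition rectangle (a b c d : R) : set plane :=
  [set z | a < z 0 0 < b /\ c < z 0 1 < d].

End Jets.

(* Main.v *)
Require Import Defs.
From mathcomp Require Import all_boot all_order all_algebra.
From mathcomp Require Import all_classical all_reals all_analysis.
From mathcomp Require Import ring lra.
Import Order.TTheory GRing.Theory Num.Theory.
Import numFieldNormedType.Exports.

Local Open Scope classical_set_scope.
Local Open Scope ring_scope.

(** The proof doubles the variables.  Admissibility of u says that every upper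
    jet satisfies |p_2| <= p_1, and admissibility of v that every lower jet
    satisfies p_1 <= |p_2|; so u and v are a sub- and a supersolution of
    |u_y| - u_x = 0, an evolution equation in which -x is the time and the
    edge x = a is the final time, where no data are needed.

    Suppose u(z0) > v(z0).  Pick a polynomial H(x) which is nonnegative and
    strictly decreasing on [a, b], small at z0 and huge at x = a
    ([steep_barrier]).  On the compact product of the closed rectangle with
    itself, maximise
       u(z) - H(z_1) - v(w) - n |z - w|^2.
    For large n a maximum point (z, w) is almost on the diagonal.  It is away
    from the boundary of the rectangle, because there u - v - H <= 0: by the
    boundary inequality off the edge x = a, and by the size of H on that edge
    ([doubling]).  Hence z and w are both interior, and with
    q = 2 n (z - w) the function u is touched from above at z by a smooth
    function of gradient q + (H'(z_1), 0), while v is touched from below at w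
    by one of gradient q.  Thus
       |q_2| <= q_1 + H'(z_1) < q_1 <= |q_2|,
    which is absurd.  The test functions are sums of one-variable polynomials
    in the coordinates, for which gradient and Hessian are explicit
    ([subsolution_test], [supersolution_test]).

    Infinite values are removed beforehand: u and -v are bounded above on the
    closed rectangle, so both can be cut from below at a level -C under which
    neither can lie at a maximum point with positive value ([cut_eq]). *)

(** * Maxima of semicontinuous functions *)

(** If no point were maximal, the sets where F lies below one of its values
    would cover K.  These sets increase with that value, so compactness bounds F on
    the whole of K by one of its own values, strictly.  The cover is
    indexed along the filter generated by the superlevel sets of F. *)
Lemma compact_attains_max (X : topologicalType) (disp : Order.disp_t)
    (T : orderType disp) (K : set X) (F : X -> T) :
  compact K -> K !=set0 ->
  (forall x y, K x -> K y -> (F x < F y)%O ->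
     \forall x' \near x, K x' -> (F x' < F y)%O) ->
  exists2 x, K x & forall y, K y -> (F y <= F x)%O.
Proof.
move=> cK [k Kk] Fusc; apply: contrapT => nomax.
have above x : K x -> exists2 y, K y & (F x < F y)%O.
  move=> Kx; apply: contrapT => noy; apply: nomax; exists x => // y Ky.
  by rewrite leNgt; apply/negP => Fxy; apply: noy; exists y.
pose tail y := [set x | K x /\ (F y <= F x)%O].
have tailF : Filter (filter_from K tail).
  apply: filter_from_filter; first by exists k.
  move=> x y Kx Ky; have [Fxy|/ltW Fyx] := leP (F x) (F y).
    by exists y => // t [Kt yt]; split; split=> //; apply: le_trans yt.
  by exists x => // t [Kt yt]; split; split=> //; apply: le_trans yt.
move/compact_near_coveringP in cK.
have cover x : K x -> \forall x' \near x & y \near filter_from K tail,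
    K x' -> (F x' < F y)%O.
  move=> Kx; have [y Ky /(Fusc _ _ Kx Ky) Fxy] := above x Kx.
  exists ([set x' | K x' -> (F x' < F y)%O], tail y).
    by split=> //; exists y.
  by move=> [x' y'] [/= Fx' [_ yy']] Kx'; exact: lt_le_trans (Fx' Kx') yy'.
have [y0 Ky0 y0max] : filter_from K tail
    (fun y => K `<=` (fun x => K x -> (F x < F y)%O)). exact: (cK X (filter_from K tail) (fun y x => K x -> (F x < F y)%O)).
by have := y0max y0 (conj Ky0 (lexx _)) y0 Ky0 Ky0; rewrite ltxx.
Qed.

Definition usc_on {R : realType} {X : topologicalType} (K : set X)
    (U : X -> R) :=
  forall x a, K x -> U x < a -> \forall x' \near x, K x' -> U x' < a.

Lemma usc_onB (R : realType) (X : topologicalType) (K : set X) (U h : X -> R) :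
  usc_on K U -> continuous h -> usc_on K (fun x => U x - h x).
Proof.
move=> uscU ch x r Kx Uhr.
pose e := (r - (U x - h x)) / 2.
have er : 2 * e = r - (U x - h x) by rewrite /e; lra.
have Ue : U x < U x + e by lra.
have hnear : \forall y \near x, h x - e < h y.
  by have /cvgr_gt := ch x; apply; lra.
near=> y => Ky.
have : U y < U x + e by apply: (near (uscU _ _ Kx Ue) y).
have : h x - e < h y by near: y.
lra.
Unshelve. all: by end_near. Qed.

(** * Separable polynomial test functions *)

Section separable.
Context {R : realType}.
Local Notation plane := 'rV[R]_2.

(** Polynomials make the smoothness of test functions free, and the Hessian of
    a sum of functions of one coordinate is diagonal, hence symmetric. *)
Definition separable (c : R) (P : 'I_2 -> {poly R}) (z : plane) : R :=
  c + \sum_i (P i).[z 0 i].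

Lemma differentiable_horner_coord (p : {poly R}) (i : 'I_2) (z : plane) :
  differentiable (fun w : plane => p.[w 0 i]) z.
Proof.
apply: (@differentiable_comp _ _ _ _ (fun w : plane => w 0 i : R) (horner p)).
  exact: differentiable_coord.
exact/derivable1_diffP/derivable_horner.
Qed.

(** Along the i-th axis the difference quotient is the one-variable difference
    quotient of p; along any other axis it vanishes. *)
Lemma partial_horner_coord (p : {poly R}) (i j : 'I_2) (z : plane) :
  partial j (fun w : plane => p.[w 0 i]) z = p^`().[z 0 i] *+ (i == j).
Proof.
rewrite /partial; have [->|ij] := eqVneq i j; last first.
  rewrite /= mulr0n /derive.
  rewrite (_ : (fun h => _) = cst 0) ?lim_cst //.
  by apply/funext => h /=; rewrite !mxE /= (negbTE ij) mulr0 add0r subrr scaler0.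
have dp := is_derive_poly p (z 0 j).
rewrite mulr1n; case: dp => _ <-; rewrite /derive.
set f := (fun h => _); set g := (fun h => _); suff -> : f = g by [].
by apply/funext => h; rewrite /f /g /= !mxE !eqxx.
Qed.

Lemma differentiable_separable c P z : differentiable (separable c P) z.
Proof.
apply: differentiableD; first exact: differentiable_cst.
rewrite (_ : (fun _ => _) = \sum_i (fun w : plane => (P i).[w 0 i])).
  by apply: differentiable_sum => i; exact: differentiable_horner_coord.
by apply/funext => w; rewrite fct_sumE.
Qed.

Lemma partial_separable c P j :
  partial j (separable c P) = fun z => (P j)^`().[z 0 j].
Proof.
apply/funext => z; rewrite /partial.
rewrite (_ : separable c P =
   cst c + \sum_i (fun w : plane => (P i).[w 0 i])); last first.
  by apply/funext => w; rewrite fctE fct_sumE.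
have dP i : derivable (fun w : plane => (P i).[w 0 i]) z (delta_mx 0 j).
  exact/diff_derivable/differentiable_horner_coord.
rewrite deriveD; [|exact: derivable_cst|exact: derivable_sum].
rewrite derive_cst add0r derive_sum //.
under eq_bigr do rewrite -/(partial j _ z) partial_horner_coord.
rewrite (bigD1 j) //= eqxx mulr1n big1 ?addr0 // => i /negbTE ->.
by rewrite mulr0n.
Qed.

Lemma gradient_separable c P :
  gradient (separable c P) = fun z => \row_i (P i)^`().[z 0 i].
Proof.
by apply/funext => z; apply/rowP => i; rewrite !mxE partial_separable.
Qed.

Lemma hessian_separable c P :
  hessian (separable c P) =
  fun z => diag_mx (\row_i (P i)^`()^`().[z 0 i]).
Proof.
apply/funext => z; apply/matrixP => i j; rewrite !mxE partial_separable.
by rewrite partial_horner_coord eq_sym; case: eqVneq => [->|//].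
Qed.

Lemma C2_separable c P z : C2_near z (separable c P).
Proof.
apply: (@filterE _ _ (nbhs_filter z)) => w; split; first exact: differentiable_separable.
- rewrite gradient_separable.
  rewrite (_ : (fun _ => _) =
    \sum_i (fun z : plane => (P i)^`().[z 0 i] *: (delta_mx 0 i : plane))).
    apply: differentiable_sum => i; apply: differentiableZl.
    exact: differentiable_horner_coord.
  by apply/funext => x; rewrite fct_sumE [LHS]row_sum_delta;
    apply: eq_bigr => i _; rewrite mxE.
- rewrite hessian_separable.
  rewrite (_ : (fun _ => _) = \sum_i (fun z : plane =>
     (P i)^`()^`().[z 0 i] *: (delta_mx i i : 'M[R]_2))).
    apply: differentiable_continuous.
    apply: differentiable_sum => i; apply: differentiableZl.
    exact: differentiable_horner_coord.
  apply/funext => x; rewrite fct_sumE diag_mx_sum_delta.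
  by apply: eq_bigr => i _; rewrite mxE.
Qed.
End separable.

(** * Gradient inequalities at touching points *)

Section tests.
Context {R : realType}.
Local Notation plane := 'rV[R]_2.
Implicit Types (Omega : set plane) (u v : plane -> \bar R) (z w : plane).

Lemma diag_mx_sym2 (d : plane) : (diag_mx d)^T == diag_mx d.
Proof. by rewrite tr_diag_mx. Qed.

Definition separable_jet c P z : jet (R := R) :=
  (separable c P z, gradient (separable c P) z,
   exist _ (diag_mx (\row_i (P i)^`()^`().[z 0 i])) (diag_mx_sym2 _)).

Lemma separable_upper_jet u z c P : u z = (separable c P z)%:E ->
  (\forall w \near z, u w <= (separable c P w)%:E)%E ->
  upper_jets z u (separable_jet c P z).
Proof.
move=> uz ule; exists (separable c P); split=> //; first exact: C2_separable.
by split=> //=; rewrite hessian_separable.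
Qed.

Lemma separable_lower_jet v z c P : v z = (separable c P z)%:E ->
  (\forall w \near z, (separable c P w)%:E <= v w)%E ->
  lower_jets z v (separable_jet c P z).
Proof.
move=> vz vge; exists (separable c P); split=> //; first exact: C2_separable.
by split=> //=; rewrite hessian_separable.
Qed.

(** The choice of the constant term that makes a test function take the value
    r at the point of contact z. *)
Lemma separable_shift (r : R) P z w :
  separable (r - separable 0 P z) P w = r + (separable 0 P w - separable 0 P z).
Proof. by rewrite /separable !add0r; lra. Qed.

Lemma subsolution_test Omega u z (r : R) P :
  admissible_subsolution Mg gfrak Omega u -> Omega z -> u z = r%:E ->
  (\forall w \near z,
     u w <= (r + (separable 0 P w - separable 0 P z))%:E)%E ->
  `|(P 1)^`().[z 0 1]| <= (P 0)^`().[z 0 0].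
Proof.
move=> usub Oz uz ule; have [|[[_ /=]]] := usub z Oz
    (separable_jet (r - separable 0 P z) P z).
- apply: separable_upper_jet; first by rewrite separable_shift subrr addr0.
  by apply: (@filterS _ _ (nbhs_filter z) _ _ _ ule) => w; rewrite separable_shift.
- by rewrite gradient_separable !mxE subr_ge0.
Qed.

(** Outside the cone p_1 >= |p_2| the inequality is immediate; inside it,
    p_1^2 <= p_2^2 forces p_1 <= |p_2| as p_1 is nonnegative. *)
Lemma supersolution_test Omega v z (r : R) P :
  admissible_supersolution Mg gfrak Omega v -> Omega z -> v z = r%:E ->
  (\forall w \near z,
     (r + (separable 0 P w - separable 0 P z))%:E <= v w)%E ->
  (P 0)^`().[z 0 0] <= `|(P 1)^`().[z 0 1]|.
Proof.
move=> vsup Oz vz vge.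
have := vsup z Oz (separable_jet (r - separable 0 P z) P z).
rewrite /Mg /gfrak /= gradient_separable !mxE subr_ge0 subr_le0.
set p := (P 0)^`().[_]; set q := (P 1)^`().[_].
case=> [|[[[_ qp] _] pq]|nM].
- apply: separable_lower_jet; first by rewrite separable_shift subrr addr0.
  by apply: (@filterS _ _ (nbhs_filter z) _ _ _ vge) => w; rewrite separable_shift.
- rewrite -ler_sqr ?nnegrE ?(le_trans _ qp) //.
  by rewrite real_normK ?num_real.
- by rewrite leNgt; apply/negP => /ltW qp; apply: nM.
Qed.

End tests.

(** * Doubling of variables *)

Section doubling.
Context {R : realType}.
Local Notation plane := 'rV[R]_2.

(** The Euclidean distance rather than the norm of row vectors, a maximum of
    coordinates: the penalty has to be a smooth test function. *)
Definition sqdist (z w : plane) : R := \sum_i (z 0 i - w 0 i) ^+ 2.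

Lemma sqdistxx z : sqdist z z = 0.
Proof. by rewrite /sqdist big1 // => i _; rewrite subrr expr0n. Qed.

Lemma sqdist_ge_coord (z w : plane) i : (z 0 i - w 0 i) ^+ 2 <= sqdist z w.
Proof.
rewrite /sqdist (bigD1 i) //= lerDl; apply: sumr_ge0 => j _; exact: sqr_ge0.
Qed.

Lemma nbhs_coord (z : plane) i (e : R) : 0 < e ->
  nbhs z [set w : plane | `|z 0 i - w 0 i| < e].
Proof.
move=> e0; have := @coord_continuous R 1 2 0 i z _ (nbhsx_ballx (z 0 i) e e0).
by [].
Qed.

Lemma sqdist_continuous : continuous (fun p : plane * plane => sqdist p.1 p.2).
Proof.
move=> p; apply: cvg_big => [|i _]; first exact: add_continuous.
have c1 : (fun q : plane * plane => q.1 0 i) @ p --> (p.1 0 i : R).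
  apply: (@continuous_comp _ _ _ fst (fun w : plane => w 0 i : R) p).
    exact: cvg_fst.
  exact: coord_continuous.
have c2 : (fun q : plane * plane => q.2 0 i) @ p --> (p.2 0 i : R).
  apply: (@continuous_comp _ _ _ snd (fun w : plane => w 0 i : R) p).
    exact: cvg_snd.
  exact: coord_continuous.
under eq_fun do rewrite expr2.
by rewrite expr2; apply: cvgM; apply: cvgB.
Qed.

Lemma sqdistC (z w : plane) : sqdist z w = sqdist w z.
Proof. by apply: eq_bigr => i _; rewrite -sqrrN opprB. Qed.

Definition parabola (k : R) (y : plane) (i : 'I_2) : {poly R} :=
  k *: ('X - (y 0 i)%:P) ^+ 2.

Lemma separable_parabola (k : R) (y z : plane) :
  separable 0 (parabola k y) z = k * sqdist z y.
Proof.
rewrite /separable add0r /sqdist mulr_sumr.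
by apply: eq_bigr => i _; rewrite !hornerE.
Qed.

Lemma deriv_parabola (k : R) (y z : plane) (i : 'I_2) :
  (parabola k y i)^`().[z 0 i] = 2 * k * (z 0 i - y 0 i).
Proof.
rewrite derivZ deriv_exp derivXsubC mul1r hornerZ hornerMn !hornerE /=.
by rewrite -mulr_natr; lra.
Qed.

(** Call a pair far if it is interior or lies strictly below the level
    M = U z0 + W z0 of the pair (z0, z0).  Each pair of K x K has a
    neighbourhood which is far for all large n: off the diagonal because the
    penalty grows, on the diagonal by semicontinuity and the assumption on
    K minus Omega.  Compactness yields one n for all pairs, and the maximum,
    being at least M, is then attained at an interior pair. *)
Lemma doubling (K Omega : set plane) (U W : plane -> R) (z0 : plane) :
  compact K -> open Omega -> usc_on K U -> usc_on K W ->
  K z0 -> 0 < U z0 + W z0 ->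
  (forall z, K z -> ~ Omega z -> U z + W z <= 0) ->
  exists n : R, exists z, exists w,
    [/\ K z /\ Omega z, K w /\ Omega w, 0 < U z + W w &
     forall z' w', K z' -> K w' ->
       U z' + W w' - n * sqdist z' w' <= U z + W w - n * sqdist z w].
Proof.
move=> cK oO uscU uscW Kz0; set M := U z0 + W z0 => M0 bdry.
have cKK : compact (K `*` K) by exact: compact_setX.
pose far (n : nat) (p : plane * plane) := K p.1 -> K p.2 ->
  U p.1 + W p.2 - n%:R * sqdist p.1 p.2 < M \/ Omega p.1 /\ Omega p.2.
have [N _ Nfar] : \forall n \near \oo, K `*` K `<=` far n.
  move/compact_near_coveringP : (cKK); apply => -[x y] [/= Kx Ky].
  have local_far A B (m : nat) : nbhs x A -> nbhs y B ->
      (forall z w n, A z -> B w -> (m <= n)%N -> far n (z, w)) ->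
      \forall p \near (x, y) & n \near \oo, far n p.
    move=> xA yB farAB.
    exists (A `*` B, [set n | (m <= n)%N]).
      by split; [exists (A, B)|exists m].
    by case=> -[z w] n [[/= Az Bw] mn]; exact: farAB.
  have [xy|/eqP xy] := pselect (x = y).
    rewrite -{}xy in local_far Ky *.
    have [Ox|nOx] := pselect (Omega x).
      have xO : nbhs x Omega by exact: open_nbhs_nbhs.
      by apply: (local_far _ _ 0%N xO xO) => z w n Oz Ow _ _ _; right.
    have Ux : U x < U x + M / 2 by lra.
    have Wx : W x < W x + M / 2 by lra.
    apply: (local_far _ _ 0%N (uscU _ _ Kx Ux) (uscW _ _ Kx Wx)).
    move=> z w n /= Uz Ww _ Kz Kw; left => /=.
    have := bdry x Kx nOx; have := Uz Kz; have := Ww Kw.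
    have : 0 <= n%:R * sqdist z w.
      by rewrite mulr_ge0 // sumr_ge0 // => i _; exact: sqr_ge0.
    lra.
  have [i xyi] : exists i, x 0 i != y 0 i.
    apply: contrapT => nxy; move/eqP: xy; apply; apply/rowP => i.
    by apply: contrapT => /eqP xyi; apply: nxy; exists i.
  (* Points within e of x and of y are at least e apart. *)
  pose e := `|x 0 i - y 0 i| / 3.
  have e0 : 0 < e by rewrite divr_gt0 // normr_gt0 subr_eq0.
  have Ux : U x < U x + 1 by lra.
  have Wy : W y < W y + 1 by lra.
  have xA := @filterI _ _ (nbhs_filter x) _ _ (nbhs_coord x i e e0) (uscU _ _ Kx Ux).
  have yB := @filterI _ _ (nbhs_filter y) _ _ (nbhs_coord y i e e0) (uscW _ _ Ky Wy).
  pose m := (Num.truncn ((U x + W y + 2 - M) / e ^+ 2)).+1.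
  apply: (local_far _ _ m xA yB) => z w n /= [xz Uz] [yw Ww] mn Kz Kw; left => /=.
  have e2 : 0 < e ^+ 2 by rewrite exprn_gt0.
  have dist : e ^+ 2 <= sqdist z w.
    apply: le_trans (sqdist_ge_coord z w i).
    rewrite -[leRHS]real_normK ?num_real // ler_sqr ?nnegrE ?(ltW e0) //.
    have : `|x 0 i - y 0 i| = 3 * e by rewrite /e; lra.
    have := ler_distD (z 0 i) (x 0 i) (y 0 i).
    have := ler_distD (w 0 i) (z 0 i) (y 0 i).
    rewrite [`|w 0 i - y 0 i|]distrC; lra.
  have : U x + W y + 2 - M < n%:R * e ^+ 2.
    rewrite -ltr_pdivrMr //; apply: lt_le_trans (truncnS_gt _) _.
    by rewrite ler_nat.
  have : n%:R * e ^+ 2 <= n%:R * sqdist z w by rewrite ler_wpM2l.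
  have := Uz Kz; have := Ww Kw; lra.
have {}Nfar := Nfar N (leqnn N).
pose Phi (p : plane * plane) : R := U p.1 + W p.2 - N%:R * sqdist p.1 p.2.
have [||[z w] [/= Kz Kw] maxzw] := @compact_attains_max _ _ _ _ Phi cKK.
- by exists (z0, z0).
- move=> [x y] q [/= Kx Ky] _; rewrite /Phi /=.
  pose b := U q.1 + W q.2 - N%:R * sqdist q.1 q.2; rewrite -/b => ltb.
  pose e := (b - (U x + W y - N%:R * sqdist x y)) / 3.
  have e0 : 0 < e by rewrite /e; lra.
  have Ux : U x < U x + e by lra.
  have Wy : W y < W y + e by lra.
  have Uxy : \forall p \near (x, y), K p.1 -> U p.1 < U x + e.
    exact: (cvg_fst (uscU _ _ Kx Ux)).
  have Wxy : \forall p \near (x, y), K p.2 -> W p.2 < W y + e.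
    exact: (cvg_snd (uscW _ _ Ky Wy)).
  have dxy : \forall p \near (x, y),
      N%:R * sqdist x y - e < N%:R * sqdist p.1 p.2.
    have : (fun p : plane * plane => N%:R * sqdist p.1 p.2) @ (x, y) -->
        N%:R * sqdist x y.
      apply: cvgM; first exact: cvg_cst.
      exact: (@sqdist_continuous (x, y)).
    move=> /cvgr_gt; apply; lra.
  near=> p => -[Kp1 Kp2].
  have : U p.1 < U x + e by apply: (near Uxy p).
  have : W p.2 < W y + e by apply: (near Wxy p).
  have : N%:R * sqdist x y - e < N%:R * sqdist p.1 p.2 by near: p.
  have : 3 * e = b - (U x + W y - N%:R * sqdist x y) by rewrite /e; lra.
  lra.
have Mzw : M <= U z + W w - N%:R * sqdist z w.
  by have := maxzw (z0, z0) (conj Kz0 Kz0); rewrite /Phi /= sqdistxx mulr0 subr0.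
have [|[Oz Ow]] := Nfar (z, w) (conj Kz Kw) Kz Kw; first by rewrite ltNge Mzw.
exists N%:R, z, w; split=> //; last first.
  by move=> z' w' Kz' Kw'; exact: (maxzw (z', w')).
apply: lt_le_trans M0 (le_trans Mzw _); rewrite gerBl mulr_ge0 //.
by apply: sumr_ge0 => i _; exact: sqr_ge0.
Unshelve. all: by end_near. Qed.

End doubling.

(** The barrier is k (b - X)^(N+1), with k normalised so that its value at a is
    C; its value at x0 is then C q^(N+1) with
    q = (b - x0) / (b - a) < 1, which is small for large N. *)
Lemma steep_barrier (R : realType) (a b x0 C e : R) :
  a < x0 -> x0 < b -> 0 < C -> 0 < e ->
  exists H : {poly R}, [/\ C <= H.[a], H.[x0] < e &
    forall x, x < b -> 0 <= H.[x] /\ H^`().[x] < 0].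
Proof.
move=> ax xb C0 e0.
have ba0 : 0 < b - a by lra.
pose q := (b - x0) / (b - a).
have q0 : 0 <= q by rewrite divr_ge0 //; lra.
have q1 : q < 1 by rewrite ltr_pdivrMr //; lra.
have qN : (fun n => q ^+ n) @ \oo --> (0 : R).
  by apply: cvg_expr; rewrite ger0_norm.
have [N _ Nq] : \forall n \near \oo, q ^+ n < e / C.
  by move/cvgr_lt : qN; apply; rewrite divr_gt0.
have {}Nq : q ^+ N.+1 < e / C by apply: Nq => /=.
pose k := C / (b - a) ^+ N.+1.
have k0 : 0 < k by rewrite divr_gt0 // exprn_gt0.
exists (k *: (b%:P - 'X) ^+ N.+1); split.
- by rewrite !hornerE divfK // expf_neq0 // gt_eqF.
- rewrite !hornerE /k mulrAC -mulrA -expr_div_n.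
  by rewrite mulrC -ltr_pdivlMr.
- move=> x xb'; split.
    by rewrite !hornerE mulr_ge0 ?exprn_ge0 //; lra.
  rewrite derivZ deriv_exp derivB derivC derivX sub0r /=.
  rewrite hornerZ hornerMn !hornerE.
  have : 0 < (b - x) ^+ N by rewrite exprn_gt0 // subr_gt0.
  set t := (b - x) ^+ N => t0.
  rewrite -mulr_natr.
  have : (0 : R) < N.+1%:R by rewrite ltr0n.
  set n : R := N.+1%:R => n0.
  have : 0 < k * (n * t) by rewrite mulr_gt0 // mulr_gt0.
  lra.
Qed.

(** * Removing infinite values *)

Section cut.
Context {R : realType}.
Local Open Scope ereal_scope.

Definition cut {X : Type} (C : R) (u : X -> \bar R) (z : X) : R :=
  fine (maxe (u z) (- C)%:E).

Lemma cutE (X : Type) (C : R) (u : X -> \bar R) z :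
  u z < +oo -> (cut C u z)%:E = maxe (u z) (- C)%:E.
Proof.
rewrite /cut; case: (u z) => [r||] // _; first by rewrite -EFin_max.
by rewrite max_r ?leNye.
Qed.

Lemma le_cut (X : Type) (C : R) (u : X -> \bar R) z :
  u z < +oo -> u z <= (cut C u z)%:E.
Proof. by move=> uy; rewrite cutE // le_max lexx. Qed.

Lemma cut_eq (X : Type) (C : R) (u : X -> \bar R) z :
  u z < +oo -> (- C < cut C u z)%R -> u z = (cut C u z)%:E.
Proof.
move=> uy; rewrite -lte_fin cutE //.
by rewrite maxEle; case: ifPn => [|//]; rewrite ltxx.
Qed.

Lemma cut_le (X : Type) (C : R) (u : X -> \bar R) z :
  (0 <= C)%R -> u z <= C%:E -> (cut C u z <= C)%R.
Proof.
move=> C0 uC; rewrite -lee_fin cutE ?(le_lt_trans uC) ?ltry//.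
by rewrite ge_max uC lee_fin; lra.
Qed.

Lemma USC_near {X : topologicalType} (K : set X) (u : X -> \bar R) x (a : R) :
  USC K u -> K x -> u x < a%:E -> \forall y \near x, K y -> u y < a%:E.
Proof.
move=> [_ usc] Kx uxa; have [V] := usc x a uxa.
case: (@nbhs_subspaceP _ K (x : subspace K)) => // _ xV uV.
have {}xV : nbhs x [set y | K y -> V y] by exact: xV.
by apply: (@filterS _ _ (nbhs_filter x) _ _ _ xV) => y Vy /Vy/uV.
Qed.

Lemma usc_cut {X : topologicalType} (K : set X) (u : X -> \bar R) (C : R) :
  USC K u -> usc_on K (cut C u).
Proof.
move=> uscu; have [uy _] := uscu; move=> x a Kx.
rewrite -lte_fin cutE ?uy // gt_max => /andP[ua Ca].
apply: filterS (USC_near _ _ _ _ uscu Kx ua) => y uya Ky.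
by rewrite -lte_fin cutE ?uy // gt_max Ca uya.
Qed.

Lemma USC_bounded {X : topologicalType} (K : set X) (u : X -> \bar R) :
  compact K -> USC K u -> exists M : R, forall x, K x -> u x <= M%:E.
Proof.
move=> /compact_near_coveringP cK uscu.
have [N _ uN] : \forall n \near \oo, K `<=` [set x | K x -> u x < n%:R%:E].
  apply: cK => x Kx.
  have [m uxm] : exists m : nat, u x < m%:R%:E.
    have := uscu.1 x Kx; case: (u x) => [r||] // _; last by exists 0%N; exact: ltNyr.
    by exists (Num.truncn r).+1; rewrite lte_fin truncnS_gt.
  exists ([set y | K y -> u y < m%:R%:E], [set n | (m <= n)%N]).
    by split; [exact: USC_near|exists m].
  move=> [y n] [/= uy mn] Ky; apply: lt_le_trans (uy Ky) _.
  by rewrite lee_fin ler_nat.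
by exists N%:R => x Kx; apply: ltW; exact: (uN N (leqnn N) x Kx Kx).
Qed.

Lemma LSC_opp {X : topologicalType} (K : set X) (v : X -> \bar R) :
  LSC K v -> USC K (fun x => - v x).
Proof.
move=> [vy lsc]; split=> [x /vy|x a]; first by rewrite lteNl.
by rewrite lteNl -EFinN => /lsc[V xV vV]; exists V => // y /vV; rewrite lteNl.
Qed.

End cut.

(** * Closed rectangles *)

Section box.
Context {R : realType}.
Local Notation plane := 'rV[R]_2.

Lemma open_rectangle (a b c d : R) : open (rectangle a b c d).
Proof.
have op (i : 'I_2) (l r : R) : open [set z : plane | l < z 0 i < r].
  rewrite (_ : [set _ | _] = (fun z : plane => z 0 i) @^-1` `]l, r[).
    apply: open_comp => [z _|]; [exact: coord_continuous|exact: interval_open].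
  by apply/seteqP; split=> z /=; rewrite in_itv.
exact: openI (op 0 a b) (op 1 c d).
Qed.

Lemma compact_box (l r : plane) :
  compact [set z : plane | forall i, l 0 i <= z 0 i <= r 0 i].
Proof.
have := @rV_compact R 2 (fun i => `[l 0 i, r 0 i]%classic)
  (fun i => @segment_compact R _ _).
by under eq_set => z do under eq_forall => i do rewrite /= in_itv /=.
Qed.

Lemma closure_rectangle_sub (a b c d : R) :
  closure (rectangle a b c d) `<=`
  [set z : plane | forall i, (\row_j (if j == 0 then a else c)) 0 i <= z 0 i
                          <= (\row_j (if j == 0 then b else d)) 0 i].
Proof.
rewrite [X in _ `<=` X](closure_id _).1; last first.
  by apply: compact_closed; [exact: norm_hausdorff|exact: compact_box].
apply: closureS => z [/andP[az zb] /andP[cz zd]] i; rewrite !mxE.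
case: i => -[|[|//]] i1 /=.
  by rewrite (_ : Ordinal i1 = 0) ?ltW //; exact/val_inj.
by rewrite (_ : Ordinal i1 = 1) ?ltW //; exact/val_inj.
Qed.

Lemma compact_closure_rectangle (a b c d : R) :
  compact (closure (rectangle a b c d) : set plane).
Proof.
apply: subclosed_compact (@closure_rectangle_sub a b c d).
  exact: closed_closure.
exact: compact_box.
Qed.

Lemma closure_rectangle_coord0 (a b c d : R) (z : plane) :
  closure (rectangle a b c d) z -> a <= z 0 0 <= b.
Proof. by move=> /closure_rectangle_sub /(_ 0); rewrite !mxE eqxx. Qed.

End box.

(** * The comparison principle *)

Theorem proposition8p8 (R : realType) (a b c d : R) (hab : a < b) (hcd : c < d)
    (u v : 'rV[R]_2 -> \bar R)
    (hu : USC (closure (rectangle a b c d)) u)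
    (hv : LSC (closure (rectangle a b c d)) v)
    (hsub : admissible_subsolution Mg gfrak (rectangle a b c d) u)
    (hsup : admissible_supersolution Mg gfrak (rectangle a b c d) v)
    (hbd : forall z : 'rV[R]_2,
       (boundary (rectangle a b c d) `\` [set w : 'rV[R]_2 | w 0 0 = a]) z ->
       (u z <= v z)%E) :
  forall z : 'rV[R]_2, rectangle a b c d z -> (u z <= v z)%E.
Proof.
move=> z0 Oz0; rewrite leNgt; apply/negP => vu.
set Omega := rectangle a b c d in hu hv hsub hsup hbd Oz0.
set K := closure Omega in hu hv.
have OK : Omega `<=` K by exact: subset_closure.
have cK : compact K by exact: compact_closure_rectangle.
have oO : open Omega by exact: open_rectangle.
have hw := LSC_opp _ _ hv; set w := (fun x => - v x)%E in hw.
have uy z : K z -> (u z < +oo)%E by exact: hu.1.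
have wy z : K z -> (w z < +oo)%E by exact: hw.1.
have [Cu uCu] := USC_bounded K u cK hu.
have [Cw wCw] := USC_bounded K w cK hw.
(* Both u and -v are at most C, so a positive value of the doubled functional
   forces each of the two to exceed -C. *)
pose C := 1 + `|Cu| + `|Cw|.
have C0 : 0 < C by have := normr_ge0 Cu; have := normr_ge0 Cw; rewrite /C; lra.
pose U := cut C u; pose W := cut C w.
have UC z : K z -> U z <= C.
  move=> Kz; apply: cut_le; first exact: ltW.
  apply: (le_trans (uCu z Kz)); rewrite lee_fin /C.
  by have := ler_norm Cu; have := normr_ge0 Cw; lra.
have WC z : K z -> W z <= C.
  move=> Kz; apply: cut_le; first exact: ltW.
  apply: (le_trans (wCw z Kz)); rewrite lee_fin /C.
  by have := ler_norm Cw; have := normr_ge0 Cu; lra.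
have uU z : K z -> (u z <= (U z)%:E)%E by move=> /uy; exact: le_cut.
have wW z : K z -> (w z <= (W z)%:E)%E by move=> /wy; exact: le_cut.
have uUE z : K z -> - C < U z -> u z = (U z)%:E.
  by move=> /uy; exact: cut_eq.
have vWE z : K z -> - C < W z -> v z = (- W z)%:E.
  by move=> /wy wz Wz; rewrite EFinN -[LHS]oppeK -(cut_eq _ _ _ _ wz Wz).
have UW0 : 0 < U z0 + W z0.
  have Kz0 := OK _ Oz0; rewrite -lte_fin EFinD.
  have := lt_le_trans vu (uU z0 Kz0).
  have := wW z0 Kz0; rewrite /w; case: (v z0) => [r||] //=.
  by rewrite lee_fin !lte_fin; lra.
have bdry z : K z -> ~ Omega z -> z 0 0 <> a -> U z + W z <= 0.
  move=> Kz nOz za.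
  have uv : (u z <= v z)%E.
    by apply: hbd; split=> //; split=> // /interior_subset.
  have [CU|] := ltP (- C) (U z); last by have := WC z Kz; lra.
  have [CW|] := ltP (- C) (W z); last by have := UC z Kz; lra.
  move: uv; rewrite (uUE z Kz CU) (vWE z Kz CW) lee_fin; lra.
have Kab z : K z -> a <= z 0 0 <= b by exact: closure_rectangle_coord0.
have [/andP[az0 z0b] _] := Oz0.
(* The right end b + 1 keeps the derivative of H negative also at x = b. *)
have [||||H [Ha Hz0 Hpos]] := @steep_barrier R a (b + 1) (z0 0 0)
  (2 * C) (U z0 + W z0) => //; [lra|lra|].
have HK z : K z -> 0 <= H.[z 0 0] /\ H^`().[z 0 0] < 0.
  by move=> /Kab/andP[_ zb]; apply: Hpos; lra.
(* The barrier is absorbed in the subsolution, so that the hypothesis of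
   the doubling lemma holds on the whole boundary, including x = a. *)
pose UH (z : 'rV[R]_2) := U z - H.[z 0 0].
have uscUH : usc_on K UH.
  apply: usc_onB; first exact: usc_cut.
  move=> z; exact: differentiable_continuous (differentiable_horner_coord H 0 z).
have [||n [z [w0 [[Kz Oz] [Kw Ow] UWzw maxzw]]]] :=
    doubling K Omega UH W z0 cK oO uscUH (usc_cut _ _ _ hw) (OK _ Oz0).
- by rewrite /UH; lra.
- move=> z Kz nOz; rewrite /UH.
  have [za|za] := pselect (z 0 0 = a).
    by rewrite za; have := UC z Kz; have := WC z Kz; lra.
  by have := bdry z Kz nOz za; have [] := HK z Kz; lra.
have [Hz H'z] := HK z Kz.
have Uz : - C < U z by have := WC w0 Kw; rewrite /UH in UWzw; lra.
have Ww : - C < W w0 by have := UC z Kz; rewrite /UH in UWzw; lra.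
have nearK (x : 'rV[R]_2) : Omega x -> \forall y \near x, K y.
  move=> Ox; apply: (@filterS _ _ (nbhs_filter x) _ _ OK).
  exact: open_nbhs_nbhs.
pose P i := parabola n w0 i + (if i == 0 then H else 0).
have PE x : separable 0 P x = n * sqdist x w0 + H.[x 0 0].
  rewrite -separable_parabola /separable !add0r /P.
  under eq_bigr do rewrite hornerD.
  rewrite big_split /=; congr (_ + _).
  by rewrite (bigD1 0) //= big1 ?addr0 // => i /negbTE ->; rewrite horner0.
have := subsolution_test Omega u z (U z) P hsub Oz (uUE _ Kz Uz).
rewrite /P /= addr0 derivD hornerD !deriv_parabola => Q.
have {}Q : `|2 * n * (z 0 1 - w0 0 1)|
    <= 2 * n * (z 0 0 - w0 0 0) + H^`().[z 0 0].
  apply: Q; rewrite -/P.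
  have Kz' := nearK _ Oz; near=> x.
  have Kx : K x by near: x.
  apply: le_trans (uU x Kx) _; rewrite lee_fin !PE.
  by have := maxzw x w0 Kx Kw; rewrite /UH; lra.
have := supersolution_test Omega v w0 (- W w0) (parabola (- n) z) hsup Ow
  (vWE _ Kw Ww).
rewrite !deriv_parabola => Q'.
have {}Q' : 2 * - n * (w0 0 0 - z 0 0) <= `|2 * - n * (w0 0 1 - z 0 1)|.
  apply: Q'; have Kw' := nearK _ Ow; near=> x.
  have Kx : K x by near: x.
  rewrite !separable_parabola.
  have := wW x Kx; rewrite /w leeNl; apply: le_trans.
  rewrite -EFinN lee_fin.
  by have := maxzw z x Kz Kx; rewrite !(sqdistC _ z); lra.
have flip i : 2 * - n * (w0 0 i - z 0 i) = 2 * n * (z 0 i - w0 0 i) by lra.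
rewrite !flip in Q'; lra.
Unshelve. all: by end_near. Qed.
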